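(* Let $X,Y$ be Banach spaces, let $F\colon X\rightrightarrows Y$ be a set-valued mapping, let $g\colon X\to Y$ be a single-valued mapping, and let $\bar x$ be a solution of the generalized equation $$0\in g(x)+F(x),$$ where $g$ is $C^1$-smooth on some convex neighborhood $U$ of $\bar x$. Given a starting point $x_0\in U$ and a sequence of bounded linear operators $B_k\colon X\to Y$, let $\{x_k\}$ be a sequence satisfying $$0\in g(x_k)+B_k(x_{k+1}-x_k)+F(x_{k+1}),\quad k=0,1,\ldots,$$ such that $\{x_k\}\subset U$ and $x_k\to\bar x$ as $k\to\infty$. Assume that $F$ is strongly metrically $q$-subregular at $(\bar x,-g(\bar x))$ with some $q\ge1$ and that there exist positive numbers $\kappa,\lambda$ for which $$\mathrm{ssubreg}^qF\big(\bar x,-g(\bar x)\big)<\kappa\quad\text{and}\quad\mathrm{lip}\,g(\bar x)<\lambda<\big(\kappa^{1/q}\big)^{-1}.$$ Suppose also that $x_k\ne\bar x$ for all $k\in\mathbb{N}$. Then $$\lim_{k\to\infty}\frac{\big\|\big(B_k-\nabla g(\bar x)\big)(x_{k+1}-x_k)\big\|}{\|x_{k+1}-x_k\|}=0\quad\Longrightarrow\quad\lim_{k\to\infty}\frac{\|x_{k+1}-\bar x\|}{\|x_k-\bar x\|^q}=0.$$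
   Context: $\mathbb{N}=\{1,2,\ldots\}$; $\mathbb{B}(x,r)$ is the closed ball of center $x$ and radius $r$; $d(y;\Omega)=\inf_{w\in\Omega}\|y-w\|$, with $d(y;\emptyset)=\infty$; $\mathrm{gph}\,F=\{(x,y):y\in F(x)\}$. In the first limit a quotient $0/0$ (arising if $x_{k+1}=x_k$) is read as $0$. A set-valued mapping $F\colon X\rightrightarrows Y$ with $(\bar x,\bar y)\in\mathrm{gph}\,F$ is strongly metrically $q$-subregular at $(\bar x,\bar y)$ if there are $\eta,\gamma>0$ such that $$\|x-\bar x\|\le\eta\,\big[d\big(\bar y;F(x)\big)\big]^q\quad\text{for all }x\in\mathbb{B}(\bar x,\gamma).$$ The exact strong $q$-subregularity bound $\mathrm{ssubreg}^qF(\bar x,\bar y)$ is the infimum of all $\eta>0$ for which this holds with some $\gamma>0$; the superscript $q$ in $\mathrm{ssubreg}^q$ is a label, not a power. For $g$ locally Lipschitzian around $\bar x$, $\displaystyle\mathrm{lip}\,g(\bar x):=\limsup_{x,u\to\bar x,\ x\ne u}\frac{\|g(x)-g(u)\|}{\|x-u\|}$. *)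

(* Defs.v *)
From HB Require Import structures.
From mathcomp Require Import all_boot all_order all_algebra.
From mathcomp Require Import all_classical all_reals all_analysis.
Set Implicit Arguments.
Unset Strict Implicit.
Unset Printing Implicit Defensive.
Import Order.TTheory GRing.Theory Num.Theory.
Import numFieldNormedType.Exports.
Local Open Scope classical_set_scope.
Local Open Scope ring_scope.

(* Set-valued mappings from X to Y are functions X -> set Y. *)
Definition gph (X Y : Type) (F : X -> set Y) : set (X * Y) :=
  [set p | F p.1 p.2].

Definition translate (R : realType) (Y : normedModType R) (y : Y) (A : set Y) :
  set Y := [set y + w | w in A].

(* Valued in \bar R, so that dist y set0 = +oo. *)
Definition dist (R : realType) (Y : normedModType R) (y : Y) (A : set Y) :
  \bar R := ereal_inf [set (`|y - w|)%:E | w in A].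

(* For q > 0, poweR gives +oo `^ q = +oo: the inequality holds at every x
   with F x = set0. *)
Definition ssubreg_ineq (R : realType) (X Y : normedModType R) (q : R)
    (F : X -> set Y) (xbar : X) (ybar : Y) (eta gamma : R) : Prop :=
  forall x : X, closed_ball xbar gamma x ->
    ((`|x - xbar|)%:E <= eta%:E * poweR (dist ybar (F x)) q)%E.

Definition strongly_subregular (R : realType) (X Y : normedModType R) (q : R)
    (F : X -> set Y) (xbar : X) (ybar : Y) : Prop :=
  gph F (xbar, ybar) /\
  exists eta gamma : R,
    [/\ 0 < eta, 0 < gamma & ssubreg_ineq q F xbar ybar eta gamma].

Definition ssubreg (R : realType) (X Y : normedModType R) (q : R)
    (F : X -> set Y) (xbar : X) (ybar : Y) : \bar R :=
  ereal_inf [set eta%:E | eta in [set eta : R | 0 < eta /\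
    exists gamma : R, 0 < gamma /\ ssubreg_ineq q F xbar ybar eta gamma]].

Definition lip (R : realType) (X Y : normedModType R) (g : X -> Y) (xbar : X) :
  \bar R :=
  limf_esup (fun p : X * X => (`|g p.1 - g p.2| / `|p.1 - p.2|)%:E)
    (within [set p : X * X | p.1 != p.2] (nbhs (xbar, xbar))).

Definition opnorm (R : realType) (X Y : normedModType R) (T : X -> Y) :
  \bar R := ereal_sup [set (`|T h|)%:E | h in [set h : X | `|h| <= 1]].

(* Frechet differentiability at each point of U, with the derivative
   continuous on U for the operator norm; U need not be open. *)
Definition C1_on (R : realType) (X Y : normedModType R) (g : X -> Y)
    (U : set X) : Prop :=
  (forall x, U x -> differentiable g x) /\
  (forall x, U x ->
     opnorm (fun h => 'd g u h - 'd g x h) @[u --> within U (nbhs x)]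
       --> (0%E : \bar R)).

(* Main.v *)
Require Import Defs.
From HB Require Import structures.
From mathcomp Require Import all_boot all_order all_algebra.
From mathcomp Require Import all_classical all_reals all_analysis.
From mathcomp Require Import ring lra.
Set Implicit Arguments.
Unset Strict Implicit.
Unset Printing Implicit Defensive.
Import Order.TTheory GRing.Theory Num.Theory.
Import numFieldNormedType.Exports.
Local Open Scope classical_set_scope.
Local Open Scope ring_scope.

(* With e_k = x_k - xbar, d_k = x_{k+1} - x_k and A the derivative of g at xbar,
   the residual entering the subregularity inequality at x_{k+1} is
     g(x_k) - g(xbar) + B_k d_k = (B_k - A) d_k
       + [g(x_k) - g(xbar) - A e_k] - [g(x_{k+1}) - g(xbar) - A e_{k+1}]
       + [g(x_{k+1}) - g(xbar)],
   hence at most 2 eps |e_k| + (2 eps + lambda) |e_{k+1}|. Taking q-th roots and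
   using |e_{k+1}| <= |e_{k+1}|^(1/q), the last term is absorbed on the left
   because kappa^(1/q) lambda < 1, which leaves |e_{k+1}| = o(|e_k|^q). *)

(** The limsup over pairs is restricted to the slice of pairs [(z, xbar)]. The diagonal point
    [z = xbar], which the limsup excludes, is trivial. *)
Lemma lip_lt_near (R : realType) (X Y : normedModType R) (g : X -> Y)
    (xbar : X) (lambda : R) :
  (lip g xbar < lambda%:E)%E ->
  \forall z \near xbar, `|g z - g xbar| <= lambda * `|z - xbar|.
Proof.
move=> /ereal_inf_lt[_ [V /= VF <-]] supV.
have to_diag : (z, xbar) @[z --> xbar] --> (xbar, xbar).
  by apply: cvg_pair; [exact: cvg_id | exact: cvg_cst].
have near_V : \forall z \near xbar, z != xbar -> V (z, xbar) := to_diag _ VF.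
apply: filterS near_V => z Vz.
have [->|zx] := eqVneq z xbar; first by rewrite !subrr !normr0 mulr0.
rewrite -ler_pdivrMr ?normr_gt0 ?subr_eq0// -lee_fin ltW//.
apply: le_lt_trans supV; apply: ereal_sup_ubound.
by exists (z, xbar) => //; exact: Vz.
Qed.

(** Some admissible [eta] lies below [kappa]. The distance to [F z] is at most the distance to any
    single [w] in it, and the power is monotone on [[0, +oo]]. *)
Lemma ssubreg_lt_near (R : realType) (X Y : normedModType R) (q : R)
    (F : X -> set Y) (xbar : X) (ybar : Y) (kappa : R) :
  0 < q -> (ssubreg q F xbar ybar < kappa%:E)%E ->
  \forall z \near xbar, forall w, F z w ->
    `|z - xbar| <= kappa * `|ybar - w| `^ q.
Proof.
move=> q0 /ereal_inf_lt[_ [eta [eta0 [gamma [gamma0 sub]]] <-]].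
rewrite lte_fin => eta_kappa; near=> z => w Fzw.
have /sub : closed_ball xbar gamma z.
  by rewrite closed_ballE//; near: z; exact: cvgr_dist_le.
move=> /le_trans sub_z; rewrite -lee_fin; apply: sub_z.
have dist_ge0 : (0 <= dist ybar (F z))%E.
  by apply: le_ereal_inf_tmp => _ [v _ <-]; rewrite lee_fin.
apply: (@le_trans _ _ (eta%:E * poweR (`|ybar - w|%:E) q)%E).
  rewrite lee_pmul2l ?fin_numE// ?lte_fin//.
  apply: gt0_ler_poweR; first exact: ltW.
  - by rewrite in_itv/= dist_ge0 leey.
  - by rewrite in_itv/= lee_fin normr_ge0 leey.
  by apply: ge_ereal_inf; exists (`|ybar - w|%:E) => //; exists w.
by rewrite lee_fin ler_wpM2r ?powR_ge0// ltW.
Unshelve. all: by end_near. Qed.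

Lemma differentiable_remainder_le (R : realType) (X Y : normedModType R)
    (g : X -> Y) (xbar : X) (eps : R) :
  differentiable g xbar -> 0 < eps ->
  \forall z \near xbar,
    `|g z - g xbar - 'd g xbar (z - xbar)| <= eps * `|z - xbar|.
Proof.
move=> /diff_locally /eqaddoP /(_ eps) /[apply] rem.
have : (fun z => z - xbar) @ xbar --> (0 : X).
  by rewrite -(subrr xbar); apply: cvgB; [exact: cvg_id | exact: cvg_cst].
move=> /(_ _ rem) near_rem.
have {}near_rem : \forall z \near xbar,
    `|(g \o shift xbar - (cst (g xbar) + 'd g xbar)) (z - xbar)|
      <= eps * `|z - xbar| := near_rem.
apply: filterS near_rem => z /=.
by rewrite !fctE /= subrK opprD addrA.
Qed.

Lemma powR_superlinear_step (R : realType) (q kappa lambda eps s t : R) :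
  1 <= q -> 0 < kappa -> 0 < lambda -> kappa `^ q^-1 * lambda < 1 ->
  0 <= s -> 0 < t <= 1 -> 0 < eps <= 1 ->
  let delta := eps * (1 - kappa `^ q^-1 * lambda) / (4 * kappa `^ q^-1) in
  t <= kappa * (2 * delta * s + (2 * delta + lambda) * t) `^ q ->
  t <= eps * s `^ q.
Proof.
move=> q1 kappa0 lambda0 cl1 s0 /andP[t0 t1] /andP[eps0 eps1] delta.
have q0 : 0 < q by lra.
set c := kappa `^ q^-1 in cl1 delta *.
have c0 : 0 < c by rewrite powR_gt0.
have cdelta : c * delta = eps * (1 - c * lambda) / 4.
  by rewrite /delta; field; rewrite gt_eqF.
have delta0 : 0 < delta by rewrite divr_gt0 ?mulr_gt0 ?subr_gt0//; lra.
set u := (X in X `^ q) => step.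
have u0 : 0 <= u by rewrite addr_ge0// mulr_ge0//; lra.
have root_step : t `^ q^-1 <= c * u.
  rewrite -[u](@powRr1 _ u)// -(@mulfV _ q) ?gt_eqF// powRrM.
  rewrite -powRM ?powR_ge0 ?(ltW kappa0)//.
  by apply: ge0_ler_powR; rewrite ?nnegrE ?invr_ge0 ?mulr_ge0 ?powR_ge0//; lra.
have t_root : t <= t `^ q^-1 by rewrite ger1_powR ?t0// invf_le1.
have root_le : t `^ q^-1 <= eps * s.
  set r := t `^ q^-1 in root_step t_root *.
  have cu : c * u = eps * (1 - c * lambda) / 2 * (s + t) + c * lambda * t.
    by rewrite /u; transitivity (2 * (c * delta) * (s + t) + c * lambda * t);
      [ring | rewrite cdelta; field].
  have clt : c * lambda * t <= c * lambda * r.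
    by rewrite ler_wpM2l// mulr_ge0 ?ltW.
  (* The term [c * lambda * r] moves to the left, and 1 - c * lambda > 0 is divided out. Since eps *
     t <= t <= r, half of [r] is then absorbed in turn. *)
  have r_le : r <= eps / 2 * (s + t).
    by rewrite -(@ler_pM2l _ (1 - c * lambda)) ?subr_gt0//; lra.
  have epst : eps * t <= t by rewrite ger_pMl.
  lra.
rewrite -[t](@powRr1 _ t) ?(ltW t0)// -(@mulVf _ q) ?gt_eqF// powRrM.
apply: (@le_trans _ _ ((eps * s) `^ q)).
  by apply: ge0_ler_powR; rewrite ?nnegrE ?powR_ge0 ?mulr_ge0//; lra.
by rewrite ge1r_powRZ// eps0.
Qed.

Theorem theorem5p1 (R : realType) (X Y : completeNormedModType R)
    (F : X -> set Y) (g : X -> Y) (xbar : X) (U : set X)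
    (B : nat -> {linear X -> Y}) (x : nat -> X) (q kappa lambda : R)
    (hsol : translate (g xbar) (F xbar) 0)
    (hUnbhs : nbhs xbar U)
    (hUconvex : convex_set U)
    (hC1 : C1_on g U)
    (hB : forall k, bounded_fun_norm (B k))
    (hiter : forall k,
       translate (g (x k) + B k (x k.+1 - x k)) (F (x k.+1)) 0)
    (hxU : forall k, U (x k))
    (hxcvg : x @ \oo --> xbar)
    (hq : 1 <= q)
    (hF : strongly_subregular q F xbar (- g xbar))
    (hkappa : 0 < kappa)
    (hlambda : 0 < lambda)
    (hssub : (ssubreg q F xbar (- g xbar)%R < kappa%:E)%E)
    (hlip : (lip g xbar < lambda%:E)%E)
    (hlk : lambda < (kappa `^ q^-1)^-1)
    (hneq : forall k, (0 < k)%N -> x k != xbar) :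
  (`|B k (x k.+1 - x k) - 'd g xbar (x k.+1 - x k)| / `|x k.+1 - x k|)
    @[k --> \oo] --> (0 : R) ->
  (`|x k.+1 - xbar| / `|x k - xbar| `^ q) @[k --> \oo] --> (0 : R).
Proof.
move=> hDM.
have q0 : 0 < q by lra.
set c := kappa `^ q^-1 in hlk.
have c0 : 0 < c by rewrite powR_gt0.
have cl1 : c * lambda < 1 by rewrite mulrC -ltr_pdivlMr// div1r.
have dg : differentiable g xbar by apply: hC1.1; exact: nbhs_singleton.
have xS : x k.+1 @[k --> \oo] --> xbar by rewrite -cvg_shiftS in hxcvg.
apply/cvgr0Pnorm_le => e e0.
(* The cap at 1 meets the condition on [eps] in [powR_superlinear_step]. *)
pose eps := Num.min e 1.
have eps0 : 0 < eps by rewrite lt_min e0 ltr01.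
have eps1 : eps <= 1 by rewrite ge_min lexx orbT.
pose delta := eps * (1 - c * lambda) / (4 * c).
have delta0 : 0 < delta by rewrite divr_gt0 ?mulr_gt0 ?subr_gt0//; lra.
near=> k.
have xk_neq : 0 < `|x k - xbar|.
  by rewrite normr_gt0 subr_eq0 hneq//; near: k; exact: nbhs_infty_gt.
have xk1_neq : 0 < `|x k.+1 - xbar| by rewrite normr_gt0 subr_eq0 hneq.
rewrite ger0_norm ?divr_ge0 ?powR_ge0// ler_pdivrMr ?powR_gt0//.
suff : `|x k.+1 - xbar| <= eps * `|x k - xbar| `^ q.
  by move=> /le_trans; apply; rewrite ler_wpM2r ?powR_ge0// ge_min lexx.
have xk1_le1 : `|x k.+1 - xbar| <= 1.
  by near: k; apply: cvgr0_norm_le => //; apply/subr_cvg0.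
apply: (@powR_superlinear_step _ _ kappa lambda);
  rewrite -/c ?eps0 ?eps1 ?xk1_neq ?normr_ge0//.
rewrite -/delta.
have rem_k : `|g (x k) - g xbar - 'd g xbar (x k - xbar)|
    <= delta * `|x k - xbar|.
  by near: k; exact: hxcvg _ (differentiable_remainder_le dg delta0).
have rem_k1 : `|g (x k.+1) - g xbar - 'd g xbar (x k.+1 - xbar)|
    <= delta * `|x k.+1 - xbar|.
  by near: k; exact: xS _ (differentiable_remainder_le dg delta0).
have lip_k1 : `|g (x k.+1) - g xbar| <= lambda * `|x k.+1 - xbar|.
  by near: k; exact: xS _ (lip_lt_near hlip).
have DM_k : `|B k (x k.+1 - x k) - 'd g xbar (x k.+1 - x k)|
    <= delta * `|x k.+1 - x k|.
  (* When the step vanishes, the quotient is 0/0 = 0 and carries no information, but both sides are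
     zero by linearity. *)
  have [->|dk] := eqVneq (x k.+1) (x k).
    by rewrite subrr !linear0 addr0 !normr0 mulr0.
  rewrite -ler_pdivrMr ?normr_gt0 ?subr_eq0//.
  rewrite -[leLHS]ger0_norm ?divr_ge0//.
  by near: k; exact: cvgr0_norm_le.
have [w Fw /eqP] := hiter k.
rewrite addr_eq0 => /eqP wE.
have : forall w, F (x k.+1) w ->
    `|x k.+1 - xbar| <= kappa * `|- g xbar - w| `^ q.
  by near: k; exact: xS _ (ssubreg_lt_near q0 hssub).
move=> /(_ _ Fw) /le_trans; apply.
rewrite ler_wpM2l ?(ltW hkappa)//.
have dk_le : `|x k.+1 - x k| <= `|x k.+1 - xbar| + `|x k - xbar|.
  by rewrite (distrC (x k)) ler_distD.
apply: ge0_ler_powR; rewrite ?nnegrE ?normr_ge0 ?(ltW q0)//.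
  by rewrite addr_ge0 ?mulr_ge0//; lra.
have -> : - g xbar - w = (B k (x k.+1 - x k) - 'd g xbar (x k.+1 - x k))
    + (g (x k) - g xbar - 'd g xbar (x k - xbar))
    - (g (x k.+1) - g xbar - 'd g xbar (x k.+1 - xbar))
    + (g (x k.+1) - g xbar).
  (* The three derivative terms cancel because e_{k+1} = d_k + e_k. *)
  have -> : 'd g xbar (x k.+1 - xbar)
      = 'd g xbar (x k.+1 - x k) + 'd g xbar (x k - xbar).
    by rewrite -linearD addrA subrK.
  rewrite opprB [_ + (_ - (g (x k.+1) - _))]addrA subrK.
  rewrite -wE [X in _ = X + _]addrACA -opprD subrK.
  by rewrite addrA addrC [- _ + _]addrC.
apply: (le_trans (ler_normD _ _)).
apply: (le_trans (lerD (ler_normB _ _) lip_k1)).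
apply: (le_trans (lerD (lerD (ler_normD _ _) (lexx _)) (lexx _))).
(* Splitting [delta] times |d_k| between |e_k| and |e_{k+1}| doubles the [delta] of each remainder,
   whence the factors 2. *)
have := ler_wpM2l (ltW delta0) dk_le.
lra.
Unshelve. all: by end_near. Qed.
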